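(* Let $k\ge1$, $0\le t\le k$ and $r\ge 2$ be integers. Then, as formal power series in $x$ expressed through $z=z(x)$, \begin{align*} \partial_u S_{t,r}(x,u)\big|_{u=1} &=\frac{1-(1-z)^{t+1}}{z(1-z)^t}-\sum_{j=1}^{r} z^{j-1}(1-z)^{kj}\frac{t+1}{(k+1)j+t+1}\binom{(k+1)j+t+1}{j}\\ &\quad+\sum_{j=1}^{r-1} z^{j}(1-z)^{jk}\frac{t+1}{(k+1)j+t+1}\binom{(k+1)j+t+1}{j} -z^r(1-z)^{rk}\frac{t(t+1)}{(k+1)r+t+1}\binom{(k+1)r+t+1}{r}. \end{align*}
   Context: A $k_t$-Dyck path is a lattice path consisting of up-steps $(1,k)$ and down-steps $(1,-1)$ that starts at $(0,0)$, stays weakly above the line $y=-t$, and ends on the line $y=0$. $S_{t,r}(x,u)=\sum_P x^{\mathrm{up}(P)}u^{d_r(P)}$, summed over all $k_t$-Dyck paths $P$, where $\mathrm{up}(P)$ is the number of up-steps of $P$ and $d_r(P)$ is the number of down-steps between the $r$-th and $(r+1)$-th up-steps of $P$, or, if $P$ has exactly $r$ up-steps, the number of down-steps after the $r$-th up-step (and $d_r(P)=0$ if $P$ has fewer than $r$ up-steps). $z=z(x)$ denotes the unique formal power series with $z(0)=0$ satisfying $x=z(1-z)^k$. *)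

(* Defs.v *)
From HB Require Import structures.
From mathcomp Require Import all_boot all_order all_algebra.
From mathcomp Require Import boolp.
From mathcomp Require Import ring.

Set Implicit Arguments.
Unset Strict Implicit.
Unset Printing Implicit Defensive.

Import Order.TTheory GRing.Theory Num.Theory.
Local Open Scope ring_scope.

(* A formal power series is a record around its coefficient sequence rather
   than [nat -> R] itself, which may already carry pointwise ring operations. *)
Record fps (R : Type) := FPS { fps_coef : nat -> R }.
Arguments FPS {R}.
Coercion fps_coef : fps >-> Funclass.

HB.instance Definition _ (R : Type) := gen_eqMixin (fps R).
HB.instance Definition _ (R : Type) := gen_choiceMixin (fps R).

Lemma fpsP (R : Type) (a b : fps R) : (forall n, a n = b n) -> a = b.
Proof. by case: a b => [a] [b] /= ab; congr FPS; apply: funext. Qed.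

Section Zmod.
Variable R : zmodType.
Implicit Types a b c : fps R.

Definition fps0 : fps R := FPS (fun=> 0).
Definition fps_opp a : fps R := FPS (fun n => - a n).
Definition fps_add a b : fps R := FPS (fun n => a n + b n).

Fact fps_addA : associative fps_add.
Proof. by move=> a b c; apply: fpsP => n /=; rewrite addrA. Qed.
Fact fps_addC : commutative fps_add.
Proof. by move=> a b; apply: fpsP => n /=; rewrite addrC. Qed.
Fact fps_add0 : left_id fps0 fps_add.
Proof. by move=> a; apply: fpsP => n /=; rewrite add0r. Qed.
Fact fps_addN : left_inverse fps0 fps_opp fps_add.
Proof. by move=> a; apply: fpsP => n /=; rewrite addNr. Qed.

HB.instance Definition _ := GRing.isZmodule.Build (fps R)
  fps_addA fps_addC fps_add0 fps_addN.

Lemma fpscoef0 n : (0 : fps R) n = 0. Proof. by []. Qed.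
Lemma fpscoefD a b n : (a + b) n = a n + b n. Proof. by []. Qed.
Lemma fpscoefN a n : (- a) n = - a n. Proof. by []. Qed.
Lemma fpscoefB a b n : (a - b) n = a n - b n. Proof. by []. Qed.
Lemma fpscoef_sum (I : Type) (r : seq I) (P : pred I) (F : I -> fps R) n :
  (\sum_(i <- r | P i) F i) n = \sum_(i <- r | P i) F i n.
Proof. by elim/big_rec2: _ => [|i x y _ <-]; rewrite ?fpscoef0. Qed.
End Zmod.

(* Multiplication and inversion are locked to keep unification from unfolding
   them. *)
HB.lock Definition fps_mul (R : comNzRingType) (a b : fps R) : fps R :=
  FPS (fun n => \sum_(i < n.+1) a i * b (n - i)%N).

Section ComRing.
Variable R : comNzRingType.
Implicit Types a b c : fps R.

Definition fps1 : fps R := FPS (fun n => (n == 0%N)%:R).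

Lemma fps_mulE a b n : fps_mul a b n = \sum_(i < n.+1) a i * b (n - i)%N.
Proof. by rewrite unlock. Qed.

Let trunc N a : {poly R} := \poly_(i < N.+1) a i.

Let mul_trunc N n a b : (n <= N)%N ->
  (fps_mul a b) n = (trunc N a * trunc N b)`_n.
Proof.
move=> nN; rewrite coefM fps_mulE; apply: eq_bigr => i _.
have iN : (i <= n)%N by rewrite -ltnS.
rewrite !coef_poly !ltnS (leq_trans iN nN).
by rewrite (leq_trans (leq_subr _ _) nN).
Qed.

Fact fps_mulC : commutative (@fps_mul R).
Proof.
by move=> a b; apply: fpsP => n; rewrite !(@mul_trunc n) // mulrC.
Qed.
Fact fps_mulA : associative (@fps_mul R).
Proof.
move=> a b c; apply: fpsP => n.
transitivity ((trunc n a * (trunc n b * trunc n c))`_n).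
  rewrite coefM fps_mulE; apply: eq_bigr => i _.
  by rewrite coef_poly ltn_ord -mul_trunc ?leq_subr.
rewrite mulrA coefM fps_mulE; apply: eq_bigr => i _.
have iN : (i <= n)%N by rewrite -ltnS.
by rewrite -mul_trunc // coef_poly ltnS leq_subr.
Qed.
Fact fps_mul1 : left_id fps1 (@fps_mul R).
Proof.
move=> a; apply: fpsP => n; rewrite fps_mulE big_ord_recl /= mul1r subn0.
by rewrite big1 ?addr0 // => i _; rewrite mul0r.
Qed.
Fact fps_mulD : left_distributive (@fps_mul R) +%R.
Proof.
move=> a b c; apply: fpsP => n; rewrite fpscoefD !fps_mulE -big_split /=.
by apply: eq_bigr => i _; rewrite mulrDl.
Qed.
Fact fps_1neq0 : fps1 != 0.
Proof.
by apply/eqP => /(congr1 (fun a : fps R => a 0%N)) /= /eqP; rewrite oner_eq0.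
Qed.

HB.instance Definition _ := GRing.Zmodule_isComNzRing.Build (fps R)
  fps_mulA fps_mulC fps_mul1 fps_mulD fps_1neq0.

Definition fpsC (c : R) : fps R := FPS (fun n => if n == 0%N then c else 0).
Definition fpsX : fps R := FPS (fun n => (n == 1%N)%:R).

Lemma fpscoef1 n : (1 : fps R) n = (n == 0%N)%:R. Proof. by []. Qed.
Lemma fpscoefM a b n : (a * b) n = \sum_(i < n.+1) a i * b (n - i)%N.
Proof. exact: fps_mulE. Qed.
Lemma fpscoefM0 a b : (a * b) 0%N = a 0%N * b 0%N.
Proof. by rewrite fpscoefM big_ord1. Qed.
Lemma fpscoefX0 a m : (a ^+ m) 0%N = a 0%N ^+ m.
Proof. by elim: m => // m IH; rewrite !exprS fpscoefM0 IH. Qed.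
Lemma fpscoefCM (c : R) a n : (fpsC c * a) n = c * a n.
Proof.
rewrite fpscoefM big_ord_recl /= subn0 big1 ?addr0 // => i _.
by rewrite mul0r.
Qed.
Lemma fpscoefXM a n : (fpsX * a) n = if n is m.+1 then a m else 0.
Proof.
case: n => [|n]; first by rewrite fpscoefM0 mul0r.
rewrite fpscoefM !big_ord_recl /= mul0r add0r mul1r subSS subn0.
by rewrite big1 ?addr0 // => i _; rewrite mul0r.
Qed.
Lemma fpscoefM_lt a b m n p : (forall i, (i < m)%N -> a i = 0) ->
  (forall i, (i < n)%N -> b i = 0) -> (p < m + n)%N -> (a * b) p = 0.
Proof.
move=> a0 b0 pmn; rewrite fpscoefM big1 // => i _.
have [im|mi] := ltnP i m; first by rewrite a0 ?mul0r.
have ip : (i <= p)%N by rewrite -ltnS.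
by rewrite b0 ?mulr0 // ltn_subLR // (leq_trans pmn) // leq_add2r.
Qed.
Lemma fpscoefX_lt a m p : a 0%N = 0 -> (p < m)%N -> (a ^+ m) p = 0.
Proof.
move=> a0; elim: m p => // m IH p pm; rewrite exprS.
by apply: (@fpscoefM_lt _ _ 1 m) => // -[].
Qed.
End ComRing.

(* Geometric series: a = a_0 (1 - w) with w_0 = 0, so that
   a^-1 = a_0^-1 * \sum_i w^i, where only the i <= n contribute to x^n. *)
HB.lock Definition fps_inv (F : fieldType) (a : fps F) : fps F :=
  if a 0%N == 0 then a else
  let w := 1 - fpsC (a 0%N)^-1 * a in
  fpsC (a 0%N)^-1 * FPS (fun n => \sum_(i < n.+1) (w ^+ i) n).

Section Field.
Variable F : fieldType.
Implicit Types a b c : fps F.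

Definition fps_unit : {pred fps F} := [pred a : fps F | a 0%N != 0].

Fact fps_mulV : {in fps_unit, left_inverse 1 (@fps_inv F) *%R}.
Proof.
move=> a; rewrite inE /= => a0; rewrite unlock (negPf a0) /=.
set c := fpsC _; set w := 1 - _.
have w0 : w 0%N = 0.
  by rewrite /w fpscoefB fpscoefCM mulVf // subrr.
rewrite mulrAC; set g := FPS _.
have -> : c * a = 1 - w by rewrite /w opprB addrC subrK.
apply: fpsP => n.
transitivity (((1 - w) * \sum_(i < n.+1) w ^+ i) n).
  rewrite !fpscoefM; apply: eq_bigr => i _; congr (_ * _).
  rewrite fpscoef_sum /g /=.
  rewrite (big_ord_widen n.+1 (fun j => (w ^+ j) (n - i)%N)) ?ltnS ?leq_subr //.
  rewrite [RHS](bigID (fun j : 'I_n.+1 => (j < (n - i).+1)%N)) /=.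
  rewrite [X in _ = _ + X]big1 ?addr0 // => j.
  by rewrite -leqNgt => ji; rewrite fpscoefX_lt.
by rewrite -opprB mulNr -subrX1 opprB fpscoefB fpscoefX_lt // subr0.
Qed.
Fact fps_unitPl a b : b * a = 1 -> fps_unit a.
Proof.
move/(congr1 (fun c : fps F => c 0%N)); rewrite fpscoefM0 /= => ab.
apply/negP => /eqP a0; move: ab; rewrite a0 mulr0 => /eqP.
by rewrite eq_sym oner_eq0.
Qed.
Fact fps_invr_out : {in [predC fps_unit], @fps_inv F =1 id}.
Proof. by move=> a; rewrite !inE negbK unlock => ->. Qed.

HB.instance Definition _ := GRing.ComNzRing_hasMulInverse.Build (fps F)
  fps_mulV fps_unitPl fps_invr_out.

Fact fps_integral : GRing.integral_domain_axiom (fps F).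
Proof.
move=> a b ab0.
have val c : c != 0 -> exists m, c m != 0 /\ forall i, (i < m)%N -> c i = 0.
  move=> c0; have ex : exists n, c n != 0.
    apply: contrapT => /forallNP cN0; move/eqP: c0; apply; apply: fpsP => n.
    by apply/eqP; apply/negPn/negP/cN0.
  exists (ex_minn ex); case: ex_minnP => m cm mmin; split=> // i im.
  apply/eqP; apply: contraTT im => ci; rewrite -leqNgt; exact: mmin.
apply/orP; case: (eqVneq a 0) => [|a0]; first by left.
case: (eqVneq b 0) => [|b0]; first by right.
have [m [am ltm]] := val _ a0; have [n [bn ltn]] := val _ b0.
have := congr1 (fun c : fps F => c (m + n)%N) ab0.
have mS : (m < (m + n).+1)%N by rewrite ltnS leq_addr.
rewrite fpscoefM (bigD1 (Ordinal mS)) //= addKn big1 ?addr0 => [/eqP|i im].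
  by rewrite mulf_eq0 (negPf am) (negPf bn).
have [ilt|ige] := ltnP i m; first by rewrite ltm ?mul0r.
have mi : (m < i)%N by rewrite ltn_neqAle ige andbT eq_sym.
have imn : (i <= m + n)%N by rewrite -ltnS.
by rewrite ltn ?mulr0 // ltn_subLR // ltn_add2r.
Qed.

HB.instance Definition _ := GRing.ComUnitRing_isIntegral.Build (fps F)
  fps_integral.
End Field.

(* The field of fractions of F[[x]] is the field of Laurent series. *)
Notation "a %:L" := (tofrac a) (at level 2, left associativity, format "a %:L")
  : ring_scope.

Section ZSeries.
Variables (F : fieldType) (k : nat).

Let step (z : fps F) : fps F := fpsX F / (1 - z) ^+ k.
Let eqmod n (a b : fps F) := forall i, (i < n)%N -> a i = b i.

Let eqmodM n a b c d : eqmod n a b -> eqmod n c d -> eqmod n (a * c) (b * d).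
Proof.
move=> ab cd i iltn; rewrite !fpscoefM; apply: eq_bigr => j _.
have ji : (j <= i)%N by rewrite -ltnS.
by rewrite ab ?cd // (leq_ltn_trans _ iltn) ?leq_subr.
Qed.

Let unit1B (z : fps F) : z 0%N = 0 -> (1 - z) ^+ k \is a GRing.unit.
Proof.
move=> z0; apply: unitrX; change ((1 - z) 0%N != 0).
by rewrite fpscoefB z0 subr0 oner_neq0.
Qed.

Let eqmodV n (a b : fps F) : a \is a GRing.unit -> b \is a GRing.unit ->
  eqmod n a b -> eqmod n a^-1 b^-1.
Proof.
move=> ua ub ab i iltn.
have aE : a^-1 = (a^-1 * b^-1) * b by rewrite mulrVK.
have bE : b^-1 = (a^-1 * b^-1) * a by rewrite mulrAC mulVr // mul1r.
rewrite [in LHS]aE [in RHS]bE; apply: (eqmodM _ _ iltn) => // j jn.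
by rewrite ab.
Qed.

Let eqmod_step n (a b : fps F) : a 0%N = 0 -> b 0%N = 0 ->
  eqmod n a b -> eqmod n.+1 (step a) (step b).
Proof.
move=> a0 b0 ab [|i]; rewrite /step !fpscoefXM // ltnS => iltn.
have pX m : eqmod n ((1 - a) ^+ m) ((1 - b) ^+ m).
  elim: m => // m IH; rewrite !exprS; apply: eqmodM => // j jn.
  by rewrite !fpscoefB ab.
exact: (eqmodV (unit1B a0) (unit1B b0) (pX k)).
Qed.

Let stepE (z : fps F) : z 0%N = 0 -> (fpsX F = z * (1 - z) ^+ k <-> step z = z).
Proof.
move=> z0; rewrite /step; split=> [->|zE]; first by rewrite mulrK ?unit1B.
by rewrite -{1}zE divrK ?unit1B.
Qed.

Let step0 (z : fps F) : step z 0%N = 0. Proof. by rewrite /step fpscoefXM. Qed.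

Lemma zseries_ex_unique :
  exists! z : fps F, z 0%N = 0 /\ fpsX F = z * (1 - z) ^+ k.
Proof.
pose it n := iter n step 0.
have it0 n : it n 0%N = 0 by case: n => [|n] //; exact: step0.
have itS n : eqmod n (it n) (it n.+1).
  elim: n => [//|n IH]; exact: eqmod_step.
have itD n m : eqmod n (it n) (it (n + m)%N).
  elim: m => [|m IH i iltn]; first by rewrite addn0.
  by rewrite addnS -itS ?IH // (leq_trans iltn) ?leq_addr.
pose z := FPS (fun n => it n.+1 n).
have zit n : eqmod n z (it n).
  by move=> i iltn /=; rewrite (itD i.+1 (n - i.+1)%N) // subnKC.
have z0 : z 0%N = 0 by exact: it0.
exists z; split=> [|w [w0 /(stepE w0) wE]].
  split=> //; apply/stepE => //; apply: fpsP => n.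
  rewrite (zit n.+1) //; apply: eqmod_step => //; exact: zit.
have zw n : eqmod n z w.
  elim: n => [//|n IH i iltn]; rewrite -wE (zit n.+1) //.
  apply: (eqmod_step _ w0 _ iltn) => // j jn; by rewrite -(zit n) // IH.
by apply: fpsP => n; exact: (zw n.+1).
Qed.
End ZSeries.

(* Lattice paths starting at (0,0): [true] is an up-step (1,k) and [false] a
   down-step (1,-1). *)
Definition path_height (k : nat) (P : seq bool) : int :=
  \sum_(s <- P) (if s then k%:Z else -1).

Definition kt_dyck (k t : nat) (P : seq bool) : bool :=
  all (fun i => - t%:Z <= path_height k (take i P)) (iota 0 (size P).+1)
  && (path_height k P == 0).

Definition up_steps (P : seq bool) : nat := count id P.

(* Position i is a down-step preceded by exactly r up-steps; this is 0 when P
   has fewer than r up-steps, and counts the final down-steps when P has exactly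
   r of them. *)
Definition down_steps_after (r : nat) (P : seq bool) : nat :=
  count (fun i => ~~ nth true P i && (up_steps (take i P) == r))
        (iota 0 (size P)).

Lemma size_kt_dyck k t P : kt_dyck k t P -> size P = (k.+1 * up_steps P)%N.
Proof.
case/andP => _ /eqP hP.
have : path_height k P = (k.+1 * up_steps P)%N%:Z - (size P)%:Z.
  rewrite /path_height /up_steps; elim: (P) => [|b s IH].
    by rewrite big_nil /= muln0.
  rewrite big_cons IH /=; case: b; rewrite ?mulnDr ?muln1 ?add0n.
    by rewrite -[(size s).+1]addn1 -[k.+1]addn1 !PoszD; ring.
  by rewrite -[(size s).+1]addn1 !PoszD; ring.
by rewrite hP => /esym/eqP; rewrite subr_eq0 => /eqP [].
Qed.

(* S_{t,r}(x,u) as a series in x over Q[u].  By [size_kt_dyck] the k_t-Dyck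
   paths with n up-steps all have length (k+1)n, so the coefficient of x^n is a
   finite sum over step sequences of that length. *)
Definition dyck_gf (k t r : nat) : fps {poly rat} :=
  FPS (fun n => \sum_(P : (k.+1 * n).-tuple bool
                        | kt_dyck k t P && (up_steps P == n))
                  'X^(down_steps_after r P)).

Definition fps_partial_u (R : nzRingType) (a : fps {poly R}) : fps {poly R} :=
  FPS (fun n => (a n)^`()).

Definition fps_eval_u (R : nzRingType) (a : fps {poly R}) (v : R) : fps R :=
  FPS (fun n => (a n).[v]).

(* Main.v *)
Require Import Defs.
From mathcomp Require Import all_boot all_order all_algebra.
From mathcomp Require Import ring zify.
Import GRing.Theory.
Local Open Scope ring_scope.

Set Implicit Arguments.
Unset Strict Implicit.
Unset Printing Implicit Defensive.

Import Num.Theory.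

(** Put b = 1/(1-z), so that b = 1 + x b^(k+1), and let W_h be the series of the
    walks from height h that stay nonnegative, weighted by up-steps.  Removing
    the first step shows W_h = b^(h+1).  The end height e does not matter as long
    as e <= k: after any up-step the walk is at height at least e, and its last
    descent can be cut at e.  If A_r(h) denotes the series of the total number of
    down-steps after the r-th up-step, then
      (b - 1) (A_r(h) + (e+1) x^r [x^r] W_h) = sum_(j > r) x^j [x^j] W_h.
    For r = 0 this is the geometric sum 1 + b + ... + b^h; for r > 0 both sides
    satisfy the same first-step recursion.  The theorem is the case h = e = t,
    solved for A_r(t). *)

Section Walks.
Variable k : nat.

(** * Paths as walks on the natural numbers *)

(** Heights are naturals, so staying above the floor is built in, and the recursion strips the first
    step. *)
Fixpoint walk (e h : nat) (P : seq bool) : bool :=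
  match P with
  | [::] => h == e
  | true :: P' => walk e (h + k) P'
  | false :: P' => if h is h'.+1 then walk e h' P' else false
  end.

Lemma path_height_cons b P :
  path_height k (b :: P) = (if b then k%:Z else -1) + path_height k P.
Proof. by rewrite /path_height big_cons. Qed.

Lemma walkE e h P :
  walk e h P = all (fun i => - h%:Z <= path_height k (take i P))
                   (iota 0 (size P).+1)
               && (h%:Z + path_height k P == e%:Z).
Proof.
elim: P h => [|b P IH] h.
  by rewrite /= /path_height big_nil addr0 andbT; lia.
have iotaS m : iota 0 m.+2 = 0%N :: map S (iota 0 m.+1).
  by rewrite -[map S _]/(map (addn 1) _) -iotaDl.
have allS (a : pred nat) x s : all a (x :: s) = a x && all a s by [].
rewrite [size _]/= iotaS allS all_map take0.
rewrite {1}/path_height big_nil oppr_le0 [_ <= h%:Z]/= andTb.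
have E i : preim S (fun i => - h%:Z <= path_height k (take i (b :: P))) i =
   (- (h%:Z + if b then k%:Z else -1) <= path_height k (take i P)).
  by rewrite /= path_height_cons; lia.
rewrite (eq_all E) path_height_cons addrA.
case: b {E}; first by rewrite [LHS]/= IH PoszD.
case: h => [|h]; first by rewrite allS take0 {1}/path_height big_nil.
by rewrite [LHS]/= IH; have -> : h.+1%:Z - 1 = h%:Z by lia.
Qed.

Lemma kt_dyck_walk t P : kt_dyck k t P = walk t t P.
Proof. by rewrite walkE /kt_dyck; congr (_ && _); lia. Qed.

Lemma down_steps_after_cons r b P :
  down_steps_after r (b :: P) =
  if b then (if r is r'.+1 then down_steps_after r' P else 0%N)
  else ((r == 0%N) + down_steps_after r P)%N.
Proof.
rewrite /down_steps_after [size _]/= [iota _ _]/= -[1%N]/(1 + 0)%N iotaDl.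
rewrite [LHS]/= count_map.
case: b => /=; last by rewrite eq_sym.
by case: r => [|r]; [rewrite -[RHS](count_pred0 (iota 0 (size P)))|];
  apply: eq_count => i /=; rewrite ?andbF.
Qed.

Lemma sum_tuple_cons L (p : pred (seq bool)) (w : seq bool -> nat) :
  (\sum_(P : L.+1.-tuple bool | p P) w P =
   \sum_(P : L.-tuple bool | p (true :: P)) w (true :: P) +
   \sum_(P : L.-tuple bool | p (false :: P)) w (false :: P))%N.
Proof.
rewrite (reindex (fun x : bool * L.-tuple bool => [tuple of x.1 :: x.2])) /=.
  rewrite -(pair_big_dep xpredT (fun b (P : L.-tuple bool) => p (b :: P))
     (fun b (P : L.-tuple bool) => w (b :: P))) /=.
  by rewrite big_bool.
exists (fun P => (thead P, [tuple of behead P])) => [[b P] _|P _] /=.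
  by rewrite theadE; congr (_, _); apply: val_inj.
by rewrite [RHS]tuple_eta; apply: val_inj.
Qed.

Lemma sum_tuple0 (p : pred (seq bool)) (w : seq bool -> nat) :
  (\sum_(P : 0.-tuple bool | p P) w P = if p [::] then w [::] else 0)%N.
Proof.
rewrite big_mkcond (bigD1 [tuple]) //= big1 ?addn0 // => P.
by case/negP; rewrite [P]tuple0.
Qed.

(** * Counting walks and their down-steps *)

(** The index [i] is the height at which the first up-step starts; without up-steps only the direct
    descent remains. *)
Fixpoint nwalks (n h : nat) : nat :=
  (if n is n'.+1 then \sum_(i < h.+1) nwalks n' (i + k) else 1)%N.

Lemma nwalksS0 n : nwalks n.+1 0 = nwalks n k.
Proof. by rewrite /= big_ord1. Qed.

Lemma nwalksSS n h : nwalks n.+1 h.+1 = (nwalks n.+1 h + nwalks n (h.+1 + k))%N.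
Proof. by rewrite /= big_ord_recr. Qed.

Lemma card_walk e L n h : (e <= k)%N -> (L + e = h + k.+1 * n)%N ->
  (\sum_(P : L.-tuple bool | walk e h P && (up_steps P == n)) 1 =
   nwalks n h)%N.
Proof.
move=> ek; elim: L n h => [|L IH] n h E.
  (* The length hypothesis balances heights: with no steps left, a remaining up-step would force [e]
     to exceed [k]. *)
  have n0 : n = 0%N by case: n E => // n; rewrite mulnS; lia.
  rewrite (sum_tuple0 (fun P => walk e h P && (up_steps P == n)) (fun=> 1%N)) /=.
  by subst n; rewrite /up_steps /= andbT; case: eqP => //; lia.
rewrite (sum_tuple_cons L (fun P => walk e h P && (up_steps P == n)) (fun=> 1%N)).
rewrite /up_steps /= -/up_steps.
case: n E => [|n] E.
  rewrite big_pred0 ?add0n => [|P]; last by rewrite andbF.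
  by case: h E => [|h] E; [lia | rewrite (IH 0%N h) //; lia].
have -> : (\sum_(P : L.-tuple bool | walk e (h + k) P && (1 + count id P == n.+1)) 1
  = nwalks n (h + k))%N by apply: IH; lia.
case: h E => [|h] E; first by rewrite big_pred0 ?addn0 ?nwalksS0.
by rewrite nwalksSS addnC (IH n.+1 h) //; lia.
Qed.

(* Total number of down-steps after the [r]-th up-step over the walks from [h]
   to [e] with [n] up-steps; junk when [n = r = 0] and [h < e]. *)
Fixpoint ndowns (e r n h : nat) : nat :=
  (match r, n with
  | 0, 0 => h - e
  | 0, _ => \sum_(i < h) nwalks n i
  | r'.+1, 0 => 0
  | r'.+1, n'.+1 => \sum_(i < h.+1) ndowns e r' n' (i + k)
  end)%N.

(** For [r = 0] and [n > 0], the walks whose initial descent reaches a height [i < h] correspond to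
    the walks from [i], so this down-step contributes [nwalks n i]. For [r > 0] the first up-step
    lowers [r] and [n] by one. *)
Lemma sum_down_steps e L r n h : (e <= k)%N -> (L + e = h + k.+1 * n)%N ->
  (\sum_(P : L.-tuple bool | walk e h P && (up_steps P == n))
     down_steps_after r P = ndowns e r n h)%N.
Proof.
move=> ek; elim: L r n h => [|L IH] r n h E.
  have n0 : n = 0%N by case: n E => // n; rewrite mulnS; lia.
  rewrite (sum_tuple0 (fun P => walk e h P && (up_steps P == n))) n0.
  have -> : h = e by lia.
  by case: r => [|r]; rewrite /= ?subnn; case: ifP.
rewrite (sum_tuple_cons L (fun P => walk e h P && (up_steps P == n))).
under eq_bigr do rewrite down_steps_after_cons.
under [X in (_ + X)%N]eq_bigr do rewrite down_steps_after_cons.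
rewrite [X in (_ + X)%N]big_split /=.
have up_true (P : L.-tuple bool) :
  (up_steps (true :: P) == n) = (0 < n)%N && (up_steps P == n.-1).
  by rewrite /up_steps /=; lia.
have E1 : (\sum_(P : L.-tuple bool | walk e (h + k) P && (up_steps (true :: P) == n))
   match r with 0 => 0 | r'.+1 => down_steps_after r' P end
   = match r, n with r'.+1, n'.+1 => ndowns e r' n' (h + k) | _, _ => 0 end)%N.
  under eq_bigl do rewrite up_true.
  case: r {IH up_true} (IH) => [|r] IH; first by rewrite big1.
  case: n E => [|n] E; first by rewrite big_pred0 // => P; rewrite andbF.
  by apply: IH; lia.
rewrite E1 {E1 up_true}.
case: h E => [|h] E.
  rewrite !big_pred0 // !addn0.
  case: n E => [|n] E; first lia.
  by case: r => [|r] /=; rewrite ?big_ord0 // big_ord1.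
have -> : (\sum_(P : L.-tuple bool | walk e h P && (up_steps (false :: P) == n))
   down_steps_after r P = ndowns e r n h)%N by apply: IH; lia.
have E2 : (\sum_(P : L.-tuple bool | walk e h P && (up_steps (false :: P) == n))
   (r == 0) = (r == 0) * nwalks n h)%N.
  rewrite -(@card_walk e L) //; last lia.
  by rewrite big_distrr; apply: eq_bigr => P _; rewrite /= muln1.
rewrite E2; case: r {E2 IH} => [|r]; case: n E => [|n] E.
- by rewrite /=; lia.
- by rewrite [RHS]/= big_ord_recr /= mul1n add0n addnC.
- by [].
- by rewrite [RHS]/= big_ord_recr /= mul0n add0n addnC.
Qed.

(** * Closed formula for the number of walks *)

(** With p = h + 1 these are the Raney numbers, which satisfy the recurrence of [nwalks]. *)
Lemma nwalks_bin n h :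
  (((k + 1) * n + h + 1) * nwalks n h = (h + 1) * 'C((k + 1) * n + h + 1, n))%N.
Proof.
pose R n p : rat := p%:R / ((k + 1) * n + p)%:R * 'C((k + 1) * n + p, n)%:R.
have pos m : m != 0%N -> (m%:R : rat) != 0 by rewrite pnatr_eq0.
have R0 p : R 0%N p.+1 = 1 by rewrite /R muln0 add0n bin0 divff ?mulr1 ?pos.
(* Vanishing at p = 0 lets the recurrence [RSS] cover the case h = 0 too. *)
have RS0 m : R m.+1 0%N = 0 by rewrite /R !mul0r.
have RSS m p : R m.+1 p.+1 = R m.+1 p + R m (p + k + 1)%N.
  rewrite /R addnS.
  have -> : ((k + 1) * m + (p + k + 1) = (k + 1) * m.+1 + p)%N by lia.
  set M := ((k + 1) * m.+1 + p)%N.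
  have ME : (M%:R : rat) = (k%:R + 1) * (m%:R + 1) + p%:R.
    by rewrite /M natrD natrM natrD -[m.+1]addn1 natrD.
  have M0 : (M%:R : rat) != 0 by apply: pos; rewrite /M; lia.
  have mM : (m <= M)%N by rewrite /M; lia.
  clearbody M.
  (* Both other binomials are multiples of ['C(M, m)], which leaves an identity of rational
     functions. *)
  have c1 : (m.+1%:R * 'C(M.+1, m.+1)%:R = M.+1%:R * 'C(M, m)%:R :> rat).
    by rewrite -!natrM mul_bin_diag.
  have c2 : (m.+1%:R * 'C(M, m.+1)%:R = (M%:R - m%:R) * 'C(M, m)%:R :> rat).
    by rewrite -natrB // -!natrM mul_bin_left.
  have nz := pos m.+1 isT; have Mz := pos M.+1 isT.
  have -> : ('C(M.+1, m.+1)%:R : rat) = M.+1%:R * 'C(M, m)%:R / m.+1%:R.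
    by rewrite -c1 mulrC mulKf.
  have -> : ('C(M, m.+1)%:R : rat) = (M%:R - m%:R) * 'C(M, m)%:R / m.+1%:R.
    by rewrite -c2 mulrC mulKf.
  move: nz Mz M0; rewrite -[M.+1]addn1 -[m.+1]addn1 -[p.+1]addn1 !natrD ME.
  by move=> nz Mz M0; field; rewrite nz Mz M0.
have RE : (nwalks n h)%:R = R n h.+1.
  elim: n h => [|n IH] h; first by rewrite R0.
  elim: h => [|h IHh].
    by rewrite nwalksS0 IH RSS RS0 add0r add0n addn1.
  by rewrite nwalksSS natrD IHh IH [in RHS]RSS; congr (_ + R n _); lia.
apply/eqP; rewrite -(eqr_nat rat) !natrM RE /R -addnA !addn1.
by rewrite mulrA [_ * (_ / _)]mulrC divfK // pos //; lia.
Qed.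

(** * Generating functions in terms of z *)

Section Series.
Variable z : fps rat.
Hypothesis z0 : z 0%N = 0.
Hypothesis zE : fpsX rat = z * (1 - z) ^+ k.

Let b : fps rat := (1 - z)^-1.

Lemma unit_1Bz : 1 - z \is a GRing.unit.
Proof.
by change ((1 - z) 0%N != 0); rewrite fpscoefB z0 subr0 oner_neq0.
Qed.

(** Since x b^k = z, the last term is z b = b - 1. *)
Lemma bE : b = 1 + fpsX rat * b ^+ k.+1.
Proof.
rewrite zE exprS mulrACA -exprMn divrr ?unit_1Bz // expr1n mulr1.
by apply: (mulIr unit_1Bz); rewrite mulrDl -mulrA mulVr ?unit_1Bz //; ring.
Qed.

(** Multiplying [bE] by b^(h+1) gives the recursion [nwalksSS]. *)
Lemma coef_bX n h : (b ^+ h.+1) n = (nwalks n h)%:R.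
Proof.
elim: n h => [|n IH] h.
  have b0 : b 0%N = 1 by rewrite bE fpscoefD fpscoefXM addr0.
  by rewrite fpscoefX0 b0 expr1n.
elim: h => [|h IHh].
  by rewrite expr1 bE fpscoefD fpscoefXM fpscoef1 add0r IH nwalksS0.
rewrite exprS {1}bE mulrDl mul1r -mulrA -exprD fpscoefD fpscoefXM IHh nwalksSS.
by rewrite natrD -IH; congr (_ + (b ^+ _) n); lia.
Qed.

Let downs e r h : fps rat := FPS (fun n => (ndowns e r n h)%:R).
Let term r h : fps rat := FPS (fun n => if n == r then (nwalks r h)%:R else 0).
Let tail r h : fps rat :=
  FPS (fun n => if (r < n)%N then (nwalks n h)%:R else 0).

Lemma fpscoef_natM (m : nat) (a : fps rat) n : (m%:R * a) n = m%:R * a n.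
Proof.
rewrite !mulr_natl; elim: m => [|m IH]; first by rewrite !mulr0n.
by rewrite !mulrS fpscoefD IH.
Qed.

(** For [r = 0] the truncated difference [h - e] is genuine only if [e <= h]; for larger [r] an
    up-step has already lifted the walk to height at least [k]. *)
Lemma downs_term_tail e r h : (e <= k)%N -> (r == 0%N) ==> (e <= h)%N ->
  (b - 1) * (downs e r h + (e.+1)%:R * term r h) = tail r h.
Proof.
move=> ek; elim: r h => [|r IH] h /= eh.
  (* The correction e + 1 completes the constant term h - e to h + 1, one for each power of b. *)
  have -> : downs e 0 h + e.+1%:R * term 0 h = \sum_(i < h.+1) b ^+ i.
    apply: fpsP => n; rewrite fpscoefD fpscoef_natM fpscoef_sum big_ord_recl.
    under eq_bigr do rewrite coef_bX.
    rewrite expr0 fpscoef1 -natr_sum; case: n => [|n] /=.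
      by rewrite sum1_card card_ord mulr1 -!natrD; congr _%:R; lia.
    by rewrite mulr0 addr0 add0r.
  rewrite -subrX1; apply: fpsP => -[|n]; rewrite fpscoefB coef_bX fpscoef1 /=.
    by rewrite subrr.
  by rewrite subr0.
(* All three series satisfy F_(r+1)(h+1) = F_(r+1)(h) + x F_r(h+1+k); this is the induction
   hypothesis for the last term. *)
have step h' : (b - 1) * (fpsX rat * downs e r (h' + k)
    + e.+1%:R * (fpsX rat * term r (h' + k))) = fpsX rat * tail r (h' + k).
  by rewrite -IH; [ring | apply/implyP => _; lia].
elim: h {eh} => [|h IHh].
  rewrite -[X in _ = X](_ : fpsX rat * tail r (0 + k) = _); last first.
    by apply: fpsP => -[|n]; rewrite fpscoefXM //= ltnS big_ord1.
  rewrite -step; congr (_ * (_ + _ * _)); apply: fpsP => -[|n];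
    by rewrite fpscoefXM //= ?eqSS big_ord1.
have -> : tail r.+1 h.+1 = tail r.+1 h + fpsX rat * tail r (h.+1 + k).
  apply: fpsP => -[|n]; rewrite fpscoefD fpscoefXM ?addr0 //=.
  by rewrite ltnS big_ord_recr natrD; case: ifP; rewrite ?addr0.
rewrite -IHh -step.
have -> : downs e r.+1 h.+1 = downs e r.+1 h + fpsX rat * downs e r (h.+1 + k).
  apply: fpsP => -[|n]; rewrite fpscoefD fpscoefXM ?addr0 //=.
  by rewrite big_ord_recr natrD.
have -> : term r.+1 h.+1 = term r.+1 h + fpsX rat * term r (h.+1 + k).
  apply: fpsP => -[|n]; rewrite fpscoefD fpscoefXM ?addr0 //=.
  by rewrite eqSS [\sum_(i < h.+2) _]big_ord_recr natrD; case: ifP; rewrite ?addr0.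
by ring.
Qed.

Lemma termE r h : term r h = (nwalks r h)%:R * fpsX rat ^+ r.
Proof.
have XE m n : (fpsX rat ^+ m) n = (n == m)%:R.
  elim: m n => [|m IHm] n //.
  by rewrite exprS fpscoefXM; case: n => [|n] //; rewrite IHm.
apply: fpsP => n; rewrite fpscoef_natM XE /=.
by case: eqP; rewrite ?mulr1 ?mulr0.
Qed.

Lemma tailE r h : tail r h = b ^+ h.+1 - \sum_(0 <= j < r.+1) term j h.
Proof.
apply: fpsP => n; rewrite fpscoefB coef_bX fpscoef_sum /= big_mkord.
have [rn|nr] := ltnP r n.
  rewrite big1 ?subr0 // => i _; case: eqP => // ni.
  by have := ltn_ord i; lia.
rewrite (bigD1 (Ordinal (nr : (n < r.+1)%N))) //= eqxx big1 ?addr0 ?subrr // => i.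
by move=> /eqP ni; case: eqP => // nE; case: ni; apply: val_inj.
Qed.

Lemma partial_u_dyck_gf t r : (t <= k)%N ->
  fps_eval_u (fps_partial_u (dyck_gf k t r)) 1 = downs t r t.
Proof.
move=> tk; apply: fpsP => n /=.
rewrite -(@sum_down_steps t (k.+1 * n)) //; last by rewrite addnC.
rewrite raddf_sum horner_sum natr_sum; apply: eq_big => [P|P _] /=.
  by rewrite kt_dyck_walk.
by rewrite derivXn hornerMn hornerXn expr1n.
Qed.

(* Cutting the maximal excursion that starts with the [(r+1)]-st up-step out of
   a path with more than [r] up-steps leaves a path marked at a vertex of its
   [r]-th descent; [b] is the series of excursions. *)
Lemma dyck_gf_identity t r : (t <= k)%N -> (0 < r)%N ->
  (b - 1) * (fps_eval_u (fps_partial_u (dyck_gf k t r)) 1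
             + t.+1%:R * ((nwalks r t)%:R * fpsX rat ^+ r)) =
  b ^+ t.+1 - \sum_(0 <= j < r.+1) (nwalks j t)%:R * fpsX rat ^+ j.
Proof.
move=> tk r0; rewrite partial_u_dyck_gf // -termE downs_term_tail //.
  by rewrite tailE; congr (_ - _); apply: eq_bigr => j _; rewrite termE.
by case: r r0.
Qed.

End Series.
End Walks.

(** * Solving the identity in the fraction field *)

Lemma natr_div_mul (F : fieldType) (d w a c : nat) : d%:R != 0 :> F ->
  (d * w = a * c)%N -> a%:R / d%:R * c%:R = w%:R :> F.
Proof.
move=> d0 /(congr1 (fun m => m%:R : F)); rewrite !natrM => E.
by rewrite mulrAC -E mulrC mulKf.
Qed.

(** Multiply by (1-z)/z = 1/z - 1, the inverse of b - 1: the sum splits into one divided by z and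
    one unchanged. The j = r term of the latter turns the factor t + 1 into t. *)
Lemma solve_identity (F : fieldType) (k t r : nat) (c : nat -> F) (z A : F) :
  (0 < r)%N -> z != 0 -> 1 - z != 0 -> c 0%N = 1 ->
  ((1 - z)^-1 - 1) * (A + t.+1%:R * (c r * (z * (1 - z) ^+ k) ^+ r)) =
    (1 - z)^-1 ^+ t.+1 - \sum_(0 <= j < r.+1) c j * (z * (1 - z) ^+ k) ^+ j ->
  A = (1 - (1 - z) ^+ t.+1) / (z * (1 - z) ^+ t)
    - \sum_(1 <= j < r.+1) z ^+ (j - 1) * (1 - z) ^+ (k * j) * c j
    + \sum_(1 <= j < r) z ^+ j * (1 - z) ^+ (j * k) * c j
    - z ^+ r * (1 - z) ^+ (r * k) * (t%:R * c r).
Proof.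
move=> r0 z0 y0 c0; pose x := z * (1 - z) ^+ k.
have xX j : z ^+ j * (1 - z) ^+ (j * k) = x ^+ j.
  by rewrite /x exprMn -exprM mulnC.
pose S := \sum_(1 <= j < r) c j * x ^+ j.
have -> : \sum_(1 <= j < r.+1) z ^+ (j - 1) * (1 - z) ^+ (k * j) * c j =
    z^-1 * (S + c r * x ^+ r).
  rewrite -(@big_nat_recr _ _ _ r 1 (fun j => c j * x ^+ j)) // big_distrr /=.
  apply: eq_big_nat => -[//|j] _.
  by rewrite -xX exprS subn1 mulnC /=; field.
have -> : \sum_(1 <= j < r) z ^+ j * (1 - z) ^+ (j * k) * c j = S.
  by apply: eq_bigr => j _; rewrite xX mulrC.
rewrite big_nat_recr // big_ltn // -/S -/x c0 expr0 mulr1 /= xX.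
set w := c r * x ^+ r => E.
have -> : x ^+ r * (t%:R * c r) = t%:R * w by rewrite /w; ring.
have Y0 : (1 - z) ^+ t != 0 by rewrite expf_neq0.
have -> : A = (1 - z) / z * (((1 - z)^-1 - 1) * (A + t.+1%:R * w)) - t.+1%:R * w.
  by field; rewrite z0 y0.
rewrite E !exprS exprVn -[t.+1]addn1 natrD; move: Y0; set Y := _ ^+ t => Y0.
by field; rewrite z0 y0 Y0.
Qed.

Theorem theorem5p9 (k t r : nat) (z : fps rat) :
  (1 <= k)%N -> (t <= k)%N -> (2 <= r)%N ->
  z 0%N = 0 -> fpsX rat = z * (1 - z) ^+ k ->
  (fps_eval_u (fps_partial_u (dyck_gf k t r)) 1)%:L =
    (1 - (1 - z%:L) ^+ t.+1) / (z%:L * (1 - z%:L) ^+ t)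
    - \sum_(1 <= j < r.+1) z%:L ^+ (j - 1) * (1 - z%:L) ^+ (k * j)
        * ((t + 1)%:R / ((k + 1) * j + t + 1)%:R
           * 'C((k + 1) * j + t + 1, j)%:R)
    + \sum_(1 <= j < r) z%:L ^+ j * (1 - z%:L) ^+ (j * k)
        * ((t + 1)%:R / ((k + 1) * j + t + 1)%:R
           * 'C((k + 1) * j + t + 1, j)%:R)
    - z%:L ^+ r * (1 - z%:L) ^+ (r * k)
        * ((t * (t + 1))%:R / ((k + 1) * r + t + 1)%:R
           * 'C((k + 1) * r + t + 1, r)%:R)
  :> {fraction (fps rat)}.
Proof.
move=> _ tk r2 z0 zE.
have := dyck_gf_identity z0 zE tk (ltnW r2).
(* As [z] is not invertible as a power series, the identity is moved to the fraction field. *)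
set A := fps_eval_u _ _; move/(congr1 (fun a => a%:L)).
have uz := unit_1Bz z0.
have natL m : (m%:R : fps rat)%:L = m%:R :> {fraction (fps rat)}.
  by rewrite rmorph_nat.
have nat_neq0 m : (m.+1%:R : {fraction (fps rat)}) != 0.
  rewrite -natL tofrac_eq0; apply/eqP => /(congr1 (fun a : fps rat => a 0%N)).
  by rewrite -[_%:R]mulr1 fpscoef_natM fpscoef1 mulr1 => /eqP; rewrite pnatr_eq0.
set zL := z%:L.
have zL0 : zL != 0.
  rewrite tofrac_eq0; apply/eqP => zz; move: zE; rewrite zz mul0r.
  by move/(congr1 (fun a : fps rat => a 1%N)) => /eqP; rewrite /= oner_eq0.
have yE : (1 - z)%:L = 1 - zL by rewrite rmorphB rmorph1.
have y0 : 1 - zL != 0.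
  by rewrite -yE tofrac_eq0; apply: contraTneq uz => ->; rewrite unitr0.
have VE : ((1 - z)^-1)%:L = (1 - zL)^-1.
  by apply: (mulfI y0); rewrite divff // -yE -rmorphM divrr ?rmorph1.
have XE : (fpsX rat)%:L = zL * (1 - zL) ^+ k.
  by rewrite zE rmorphM rmorphXn /= yE.
have cE j : (t + 1)%:R / ((k + 1) * j + t + 1)%:R
           * 'C((k + 1) * j + t + 1, j)%:R
         = (nwalks k j t)%:R :> {fraction (fps rat)}.
  apply: natr_div_mul (nwalks_bin _ _ _).
  by rewrite [X in X%:R]addn1; exact: nat_neq0.
rewrite rmorphM rmorphB rmorphD rmorph1 rmorphB rmorphXn /= VE.
rewrite !rmorphM rmorphXn /= !natL XE rmorph_sum /=.
under eq_bigr do rewrite rmorphM rmorphXn /= natL XE.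
move/(solve_identity (ltnW r2) zL0 y0 erefl) => ->.
congr (_ - _ + _ - _ * _).
- by apply: eq_bigr => j _; rewrite cE.
- by apply: eq_bigr => j _; rewrite cE.
- by rewrite -cE !mulrA.
Qed.
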